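(* Let $$M(x)=\frac{ax+b}{cx+d}\in\mathbb{R}(x),\qquad a,b,c,d\in\mathbb{R},\quad ad-bc\neq0.$$ Then $M$ has Maillet's property if and only if $M\in\mathbb{Q}(x)$. Moreover, if $M\notin\mathbb{Q}(x)$, then every nonempty open interval contained in the domain of $M$ contains a Liouville number $\xi$ such that $M(\xi)$ is not a Liouville number.
   Context: A real number $\xi$ is a Liouville number if for every integer $N\ge 1$ there exist infinitely many pairs $(p,q)\in\mathbb{Z}\times\mathbb{Z}_{>0}$ with $q\ge 2$ such that $0<|\xi-p/q|<q^{-N}$. A function has Maillet's property if it maps every Liouville number in its domain to a Liouville number. The domain of $M$ is $\{x\in\mathbb{R}:cx+d\ne0\}$. The condition $M\in\mathbb{Q}(x)$ means that, as an element of $\mathbb{R}(x)$, $M$ is a rational function with rational coefficients; equivalently, $(a,b,c,d)$ is a real scalar multiple of a vector in $\mathbb{Q}^4$. *)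

(* Defs.v *)
From HB Require Import structures.
From mathcomp Require Import all_boot all_order all_algebra.
From mathcomp Require Import all_classical all_reals all_analysis.

Set Implicit Arguments.
Unset Strict Implicit.
Unset Printing Implicit Defensive.

Import Order.TTheory GRing.Theory Num.Theory.
Import numFieldNormedType.Exports.

Local Open Scope classical_set_scope.
Local Open Scope ring_scope.

Definition liouville (R : realType) (xi : R) : Prop :=
  forall N : nat, (1 <= N)%N ->
    infinite_set [set pq : int * int | (2 <= pq.2)
      /\ 0 < `|xi - pq.1%:~R / pq.2%:~R| < pq.2%:~R ^- N].

Definition maillet (R : realType) (D : set R) (f : R -> R) : Prop :=
  forall xi : R, D xi -> liouville xi -> liouville (f xi).

(* F, an element of R(x), lies in the image of Q(x) *)
Definition rational_coefs (R : realType) (F : {fraction {poly R}}) : Prop :=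
  exists p q : {poly rat}, q != 0
    /\ F = tofrac (map_poly ratr p) / tofrac (map_poly ratr q).

(* (a x + b) / (c x + d) as an element of R(x) *)
Definition mobius_frac (R : realType) (a b c d : R) : {fraction {poly R}} :=
  tofrac (a *: 'X + b%:P) / tofrac (c *: 'X + d%:P).

Definition mobius_dom (R : realType) (c d : R) : set R :=
  [set x | c * x + d != 0].

(* meaningful only on mobius_dom c d, since division by 0 yields 0 *)
Definition mobius (R : realType) (a b c d : R) (x : R) : R :=
  (a * x + b) / (c * x + d).

(* Main.v *)
(* Write M for the Moebius map. If M is irrational, at most two rational points
   have a rational image, since three of them determine M through the
   cross-ratio; so every interval contains an irrational x0 with M x0 rational.
   If x0 is Liouville, it is the required point.

   Otherwise x0 has a finite irrationality measure N, and this makes most images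
   of fractions badly approximable: if M (p_i / Q) were very close to r_i / s_i
   for three distinct p_i, with all s_i in one range [S, S^2), the cross-ratio of
   (x0, p_i / Q) and (M x0, r_i / s_i) would give a fraction too close to x0.
   Hence each of the ranges T, T^2, T^4, ... rules out at most two numerators p,
   and some p / Q in a window of length about T^-2 survives them all, with
   Q = T^4. Denominators below T are harmless because such a window meets at most
   one fraction r / s with s < T. Shrinking the window around p / Q to length
   about T^-(2 m 2^k) at step k, the nested windows converge to a Liouville
   number whose image satisfies |M xi - r / s| >= s^-(3 m) for all large s. *)

Require Import Defs.
From HB Require Import structures.
From mathcomp Require Import all_boot all_order all_algebra.
From mathcomp Require Import all_classical all_reals all_analysis.
From mathcomp Require Import ring lra zify.
Import Order.TTheory GRing.Theory Num.Theory.
Import numFieldNormedType.Exports.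
Local Open Scope classical_set_scope.
Local Open Scope ring_scope.

(** * Liouville numbers: one approximation for each exponent *)

Lemma exists_expn_ge (R : realType) (x : R) : exists n, x <= 2 ^+ n.
Proof.
have x0 : 0 <= `|x| by [].
exists (Num.bound `|x|); apply: (le_trans (ler_norm x)).
apply: (le_trans (ltW (archi_boundP x0))).
by rewrite -natrX ler_nat ltnW // ltn_expl.
Qed.

Lemma seq_pos_lower_bound (R : realType) (T : eqType) (g : T -> R) (s : seq T) :
  (forall x, x \in s -> 0 < g x) ->
  exists2 e, 0 < e & forall x, x \in s -> e <= g x.
Proof.
elim: s => [|y s IHs] gs; first by exists 1.
have [x xs|e e0 es] := IHs; first by apply: gs; rewrite inE xs orbT.
exists (Num.min e (g y)); first by rewrite lt_min e0 gs // inE eqxx.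
move=> x; rewrite inE => /orP[/eqP->|/es ex]; first by rewrite ge_min lexx orbT.
by rewrite ge_min ex.
Qed.

(** Finitely many approximations of order N keep some distance e > 0 from [xi]. Raising the exponent
    by n with 2^n >= 1/e yields one that is closer, hence new. *)
Lemma liouvilleP (R : realType) (xi : R) :
  liouville xi <-> forall N : nat, exists (p : int) (q : nat),
    (2 <= q)%N /\ 0 < `|xi - p%:~R / q%:R| < q%:R ^- N.
Proof.
split=> [xiL N|xiL N N1].
  have /infinite_setN0[[p q] /= [q2 /andP[pq0 pqN]]] := xiL N.+1 isT.
  case: q q2 pq0 pqN => // q q2 pq0 pqN.
  exists p, q; split=> //; rewrite pq0 /=; apply: (lt_le_trans pqN).
  have q1 : 1 <= q%:R :> R by rewrite ler1n; apply: ltnW.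
  rewrite lef_pV2 ?posrE ?exprn_gt0 ?(lt_le_trans _ q1) //.
  by rewrite ler_weXn2l // leqnSn.
move=> /finite_seqP[s sE].
pose g (pq : int * int) := `|xi - pq.1%:~R / pq.2%:~R|.
have [pq pqs|e e0 es] := @seq_pos_lower_bound R _ g s.
  have : [set` s] pq by [].
  by rewrite -sE /= => -[_ /andP[]].
have [n en] := exists_expn_ge R e^-1.
have [p [q [q2 /andP[pq0 pqN]]]] := xiL (N + n)%N.
have q1 : 1 <= q%:R :> R by rewrite ler1n; apply: ltnW.
have q0 := lt_le_trans ltr01 q1.
have : [set` s] (p, Posz q).
  rewrite -sE /=; split=> //; rewrite pq0 /=; apply: (lt_le_trans pqN).
  by rewrite lef_pV2 ?posrE ?exprn_gt0 // ler_weXn2l // leq_addr.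
move=> /es; rewrite /g /=; apply/negP; rewrite -ltNge; apply: (lt_le_trans pqN).
rewrite -[leRHS]invrK lef_pV2 ?posrE ?invr_gt0 ?exprn_gt0 //.
apply: (le_trans en); apply: (@le_trans _ _ (q%:R ^+ n)).
  by rewrite lerXn2r ?nnegrE ?(ltW q0) // ler_nat.
by rewrite ler_weXn2l // leq_addl.
Qed.

(** * Rationality of the coefficients *)

(** The form of M in Q(x) that the arithmetic uses; [rational_coefsP] links it to the fraction
    field. *)
Definition int_proportional (R : realType) (a b c d : R) : Prop :=
  exists l : R, l != 0 /\ exists A B C D : int,
    [/\ a = l * A%:~R, b = l * B%:~R, c = l * C%:~R & d = l * D%:~R].

Lemma rat_common_denominator (R : realType) (A B C D : rat) :
  exists (n : R) (A' B' C' D' : int), n != 0 /\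
    [/\ ratr A = n * A'%:~R, ratr B = n * B'%:~R,
        ratr C = n * C'%:~R & ratr D = n * D'%:~R].
Proof.
have dn0 (x : rat) : (denq x)%:~R != 0 :> R by rewrite intr_eq0 denq_neq0.
exists ((denq A * denq B * denq C * denq D)%:~R^-1).
exists (numq A * denq B * denq C * denq D), (numq B * denq A * denq C * denq D).
exists (numq C * denq A * denq B * denq D), (numq D * denq A * denq B * denq C).
rewrite !rmorphM /= invr_eq0 !mulf_neq0 ?dn0 //.
by split=> //; split; rewrite /ratr; field; rewrite !dn0.
Qed.

Lemma mobiusB (R : realType) (a b c d x y : R) :
  c * x + d != 0 -> c * y + d != 0 ->
  mobius a b c d x - mobius a b c d y =
  (a * d - b * c) * (x - y) / ((c * x + d) * (c * y + d)).
Proof. by move=> lx ly; rewrite /mobius; field; rewrite lx ly. Qed.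

(* The cross-ratio [x, x1; x2, x3] = [M x, y1; y2, y3] solved for M x. *)
Lemma three_rational_points (R : realType) (a b c d : R)
    (x1 x2 x3 y1 y2 y3 : rat) :
  a * d - b * c != 0 -> x1 != x2 -> x1 != x3 -> x2 != x3 ->
  c * ratr x1 + d != 0 -> c * ratr x2 + d != 0 -> c * ratr x3 + d != 0 ->
  mobius a b c d (ratr x1) = ratr y1 -> mobius a b c d (ratr x2) = ratr y2 ->
  mobius a b c d (ratr x3) = ratr y3 ->
  int_proportional R a b c d.
Proof.
move=> hdet n12 n13 n23 l1 l2 l3 e1 e2 e3.
pose A := (x2 - x3) * (y1 - y3); pose B := (x1 - x3) * (y2 - y3).
have [n [A' [B' [C' [D' [n0 [eA eB eC eD]]]]]]] := rat_common_denominator R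
  (A * y2 - B * y1) (- x1 * A * y2 + x2 * B * y1) (A - B) (- x1 * A + x2 * B).
pose X1 : R := ratr x1; pose X2 : R := ratr x2; pose X3 : R := ratr x3.
have nR (x y : rat) : x != y -> ratr x - ratr y != 0 :> R.
  by rewrite subr_eq0 (inj_eq (fmorph_inj _)).
(* The cross-ratio recovers the coefficients only up to a scalar. [G] is this scalar, nonzero
   because the three points are distinct and the determinant does not vanish. *)
pose G := (a * d - b * c) * (X1 - X3) * (X2 - X3) * (X2 - X1) /
  ((c * X1 + d) * (c * X2 + d) * (c * X3 + d)).
have G0 : G != 0.
  rewrite /G !mulf_neq0 ?invr_eq0 ?mulf_neq0 ?nR //.
  by rewrite eq_sym.
have [GA GB GC GD] : [/\ n * A'%:~R = G * a, n * B'%:~R = G * b,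
    n * C'%:~R = G * c & n * D'%:~R = G * d].
  rewrite -eA -eB -eC -eD /A /B !(rmorphD, rmorphB, rmorphM, rmorphN) /=.
  rewrite -e1 -e2 -e3 /mobius /G.
  rewrite -/X1 -/X2 -/X3.
  by split; field; rewrite l1 l2 l3.
exists (G^-1 * n); split; first by rewrite mulf_neq0 ?invr_eq0.
exists A', B', C', D'.
by rewrite -!mulrA GA GB GC GD !mulKf.
Qed.

Lemma exists_nat_nonroot (R : realType) (h : {poly R}) :
  h != 0 -> exists n : nat, ~~ root h n%:R.
Proof.
move=> h0; apply: contrapT => hn.
have /(max_poly_roots h0) : all (root h) [seq n%:R | n <- iota 0 (size h)].
  apply/allP => _ /mapP[n _ ->]; apply: contrapT => /negP hr.
  by apply: hn; exists n.
rewrite map_inj_in_uniq ?iota_uniq => [|x y _ _ /eqP]; last first.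
  by rewrite eqr_nat => /eqP.
by rewrite size_map size_iota ltnn => /(_ isT).
Qed.

Lemma exists_three_nat_nonroots (R : realType) (h : {poly R}) : h != 0 ->
  exists n1 n2 n3 : nat, [/\ n1 != n2, n1 != n3, n2 != n3 &
    [/\ ~~ root h n1%:R, ~~ root h n2%:R & ~~ root h n3%:R]].
Proof.
move=> h0; have XC0 (x : R) : 'X - x%:P != 0 by apply/monic_neq0/monicXsubC.
have [n1 r1] := @exists_nat_nonroot R h h0.
have [|n2] := @exists_nat_nonroot R (h * ('X - n1%:R%:P)).
  by rewrite mulf_neq0.
rewrite rootM root_XsubC negb_or eqr_nat => /andP[r2 n21].
have [|n3] := @exists_nat_nonroot R (h * ('X - n1%:R%:P) * ('X - n2%:R%:P)).
  by rewrite !mulf_neq0.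
rewrite !rootM !root_XsubC !negb_or !eqr_nat => /andP[/andP[r3 n31] n32].
by exists n1, n2, n3; split=> //; rewrite eq_sym.
Qed.

Lemma mobius_den_neq0 (R : realType) (a b c d : R) :
  a * d - b * c != 0 -> c *: 'X + d%:P != 0 :> {poly R}.
Proof.
apply: contra_neq => /polyP cd.
have := cd 0%N; have := cd 1%N.
rewrite !coefE /= mulr0 mulr1 addr0 add0r => -> ->.
by rewrite !mulr0 subrr.
Qed.

(** A quotient of rational polynomials takes rational values at natural numbers. Three of them off
    the zeros of both denominators feed [three_rational_points]. Conversely, the scalar [l] cancels
    from the fraction. *)
Lemma rational_coefsP (R : realType) (a b c d : R) : a * d - b * c != 0 ->
  rational_coefs (mobius_frac a b c d) <-> int_proportional R a b c d.
Proof.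
move=> hdet; have l0 := mobius_den_neq0 _ _ _ _ _ hdet.
split=> [[p [q [q0 Fpq]]]|[l [ln0 [A [B [C [D [-> -> eC eD]]]]]]]]; last first.
  have q0 : (C%:~R *: 'X + D%:~R%:P : {poly rat}) != 0.
    apply: contra_neq l0 => CD0.
    rewrite eC eD -mul_polyC !rmorphM /= -mulrA -mulrDr mul_polyC.
    have /(congr1 (map_poly (ratr : rat -> R))) := CD0.
    rewrite rmorphD /= map_polyZ map_polyX map_polyC rmorph0 /= !ratr_int => ->.
    by rewrite mulr0.
  exists (A%:~R *: 'X + B%:~R%:P), (C%:~R *: 'X + D%:~R%:P); split=> //.
  rewrite !rmorphD /= !map_polyZ !map_polyX !map_polyC /= !ratr_int /mobius_frac.
  have fact (x y : R) : (l * x) *: 'X + (l * y)%:P = l%:P * (x *: 'X + y%:P).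
    by rewrite mulrDr -mul_polyC rmorphM mul_polyC -mulrA !mul_polyC rmorphM mul_polyC.
  rewrite eC eD !fact !tofracM -mulf_div divff ?mul1r //.
    by rewrite !tofracD.
  by rewrite tofrac_eq0 polyC_eq0.
have q0R : map_poly ratr q != 0 :> {poly R} by rewrite map_poly_eq0.
have Epq : (a *: 'X + b%:P) * map_poly ratr q =
    map_poly ratr p * (c *: 'X + d%:P).
  apply/eqP; rewrite -tofrac_eq !tofracM -eqr_div ?tofrac_eq0 //.
  exact/eqP.
have [|n1 [n2 [n3 [n12 n13 n23 [r1 r2 r3]]]]] :=
  @exists_three_nat_nonroots R (map_poly ratr q * (c *: 'X + d%:P)).
  by rewrite mulf_neq0.
have val (n : nat) : ~~ root (map_poly ratr q * (c *: 'X + d%:P)) (n%:R : R) ->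
    c * ratr n%:R + d != 0 /\
    mobius a b c d (ratr n%:R) = ratr (p.[n%:R] / q.[n%:R]).
  rewrite rootM negb_or => /andP[qn ln].
  have {}ln : c * ratr n%:R + d != 0.
    by move: ln; rewrite ratr_nat /root !hornerE.
  split=> //; have {}qn : ratr q.[n%:R] != 0 :> R.
    by move: qn; rewrite /root -(ratr_nat R n) horner_map.
  have := congr1 (fun f => f.[ratr n%:R]) Epq.
  rewrite !(hornerM, horner_map, hornerD, hornerZ, hornerX, hornerC) => E.
  by rewrite /mobius fmorph_div; apply/eqP; rewrite eqr_div // E.
have [[l1 e1] [l2 e2] [l3 e3]] := And3 (val _ r1) (val _ r2) (val _ r3).
by apply: (three_rational_points _ _ _ _ _ _ _ _ _ _ _ hdet _ _ _ l1 l2 l3 e1 e2 e3);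
  rewrite eqr_nat.
Qed.

(** * Integral Moebius maps preserve Liouville numbers *)

(** M (p / q) is a fraction with denominator O(q), and M is Lipschitz near [xi]. The constants
    disappear into powers of q because q >= 2. *)
Lemma liouville_mobius_int (R : realType) (A B C D : int) (xi : R) :
  A * D - B * C != 0 -> C%:~R * xi + D%:~R != 0 -> liouville xi ->
  liouville (mobius A%:~R B%:~R C%:~R D%:~R xi).
Proof.
move=> det0 l0 /liouvilleP xiL; apply/liouvilleP => N.
set l := C%:~R * xi + D%:~R in l0 *.
have nl0 : 0 < `|l| by rewrite normr_gt0.
(* The power q^i keeps the denominator of M at p / q within half of [l], q^(j+1) bounds the new
   denominator, and q^h bounds the Lipschitz factor. *)
have [i Ci] := exists_expn_ge R (2 * `|C%:~R| / `|l|).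
have [j Kj] := exists_expn_ge R (4 * `|l|).
have [h Kh] := exists_expn_ge R (2 * `|(A * D - B * C)%:~R| / `|l| ^+ 2).
have [p [q [q2 /andP[pq0 pqN]]]] := xiL (i + h + j.+1 * N)%N.
have q2R : 2 <= q%:R :> R by rewrite ler_nat.
have q0 : 0 < q%:R :> R by apply: lt_le_trans q2R.
have q1 : 1 <= q%:R :> R by apply: le_trans q2R; rewrite ler1n.
have ge2 (n : nat) : 2 ^+ n <= q%:R ^+ n :> R by rewrite lerXn2r ?nnegrE // ltW.
set x := p%:~R / q%:R in pq0 pqN; set e := `|xi - x| in pq0 pqN.
set l' := C%:~R * x + D%:~R.
have qV (n : nat) : (0 < q%:R ^+ n :> R) by rewrite exprn_gt0.
have ll' : `|l - l'| <= `|l| / 2.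
  have -> : l - l' = C%:~R * (xi - x) by rewrite /l /l'; ring.
  rewrite normrM -/e.
  have ei : e <= q%:R ^- i.
    apply: (le_trans (ltW pqN)); rewrite lef_pV2 ?posrE // ler_weXn2l //.
    by rewrite -addnA leq_addr.
  apply: (le_trans (ler_wpM2l (normr_ge0 _) ei)).
  rewrite ler_pdivrMr //; have := le_trans Ci (ge2 i).
  by rewrite ler_pdivrMr // => ?; lra.
have l'_ge : `|l| / 2 <= `|l'|.
  by have := lerB_dist l (l - l'); rewrite subKr; lra.
have l'_le : `|l'| <= 2 * `|l|.
  by have := ler_normB l (l - l'); rewrite subKr; lra.
have l'0 : l' != 0 by rewrite -normr_gt0; lra.
pose S := C * p + D * q%:Z; pose P := A * p + B * q%:Z.
have SE : S%:~R = q%:R * l' :> R.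
  by rewrite /S rmorphD !rmorphM /= /l' /x; field; rewrite gt_eqF.
have PE : P%:~R = q%:R * (A%:~R * x + B%:~R) :> R.
  by rewrite /P rmorphD !rmorphM /= /x; field; rewrite gt_eqF.
have S0 : S != 0.
  by rewrite -(intr_eq0 R) SE mulf_neq0 // gt_eqF.
(* The sign of [S] moves to the numerator, and the factor 2 makes the denominator at least 2 even
   when [S] is a unit. *)
exists (2 * sgz S * P), (2 * `|S|)%N; split.
  by rewrite -{1}(muln1 2%N) leq_mul2l absz_gt0 S0.
have sS : (2 * `|S|)%:R = 2 * `|S%:~R| :> R.
  by rewrite natrM natr_absz intr_norm.
have MxE : (2 * sgz S * P)%:~R / (2 * `|S|)%:R =
    mobius A%:~R B%:~R C%:~R D%:~R x :> R.
  rewrite sS !rmorphM /= /mobius -/l' PE.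
  have -> : `|S%:~R| = (sgz S)%:~R * S%:~R :> R.
    by rewrite -intr_norm -rmorphM normrEsg sgrz.
  rewrite SE; field; rewrite intr_eq0 sgz_eq0 S0 l'0 gt_eqF //.
rewrite MxE mobiusB // -/l -/l' normrM normfV !normrM -/e.
set Dt := `|_|.
have DtE : Dt = `|(A * D - B * C)%:~R| by rewrite /Dt rmorphB !rmorphM.
have Dt0 : 0 < Dt by rewrite DtE normr_gt0 intr_eq0.
apply/andP; split; first by rewrite divr_gt0 ?mulr_gt0 // normr_gt0.
have up : Dt * e / (`|l| * `|l'|) <= q%:R ^+ h * e.
  rewrite ler_pdivrMr ?mulr_gt0 ?normr_gt0 //.
  rewrite -DtE in Kh.
  have : Dt * 2 <= q%:R ^+ h * `|l| ^+ 2.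
    by rewrite -ler_pdivrMr ?exprn_gt0 // (mulrC Dt); apply: le_trans Kh (ge2 h).
  have : q%:R ^+ h * (`|l| * (`|l| / 2)) <= q%:R ^+ h * (`|l| * `|l'|).
    by rewrite !ler_pM2l.
  move=> H1 H2; have : Dt <= q%:R ^+ h * (`|l| * `|l'|) by apply: le_trans H1; lra.
  by rewrite -(ler_pM2r pq0) mulrAC.
apply: (le_lt_trans up).
have : q%:R ^+ h * e < q%:R ^- (j.+1 * N).
  rewrite mulrC -ltr_pdivlMr //; apply: (lt_le_trans pqN).
  rewrite -invfM -exprD lef_pV2 ?posrE // ler_weXn2l //.
  by rewrite addnC leq_add2r leq_addl.
move=> H; apply: (lt_le_trans H).
rewrite lef_pV2 ?posrE ?exprn_gt0 // ?sS ?mulr_gt0 ?normr_gt0 ?intr_eq0 //.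
have base : 2 * `|S%:~R| <= q%:R ^+ j.+1 :> R.
  rewrite SE normrM (gtr0_norm q0) exprSr.
  by have := le_trans Kj (ge2 j) => Hj; nra.
by rewrite exprM lerXn2r ?nnegrE ?mulr_ge0 ?exprn_ge0.
Qed.

Lemma int_proportional_maillet (R : realType) (a b c d : R) :
  a * d - b * c != 0 -> int_proportional R a b c d ->
  maillet (mobius_dom c d) (mobius a b c d).
Proof.
move=> hdet [l [l0 [A [B [C [D [eA eB eC eD]]]]]]] xi; rewrite /mobius_dom /=.
have -> : mobius a b c d xi = mobius A%:~R B%:~R C%:~R D%:~R xi.
  rewrite /mobius eA eB eC eD -!mulrA -!mulrDr invfM mulrACA divff ?mul1r //.
rewrite eC eD -mulrA -mulrDr mulf_eq0 negb_or => /andP[_ lx].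
apply: liouville_mobius_int => //.
apply: contra_neq hdet => E.
have : (A * D - B * C)%:~R = 0 :> R by rewrite E.
rewrite rmorphB !rmorphM /= eA eB eC eD => ER.
have -> : l * A%:~R * (l * D%:~R) - l * B%:~R * (l * C%:~R) =
  l ^+ 2 * (A%:~R * D%:~R - B%:~R * C%:~R) by ring.
by rewrite ER mulr0.
Qed.

(** * Cross-ratios and three close fractions *)

(** Equality of the cross-ratios of four points and of their images, solved for x0, reads x0 = (x1 U
    - x2 V) / (U - V). This product is U, and exchanging the indices 1 and 2 gives V. *)
Definition cross_left (R : realType) (y0 x2 x3 y1 y2 y3 : R) : R :=
  (x2 - x3) * ((y0 - y2) * (y1 - y3)).

(** The first identity is kept free of division because the images will be replaced by
    approximations. The second one bounds the denominator U - V away from 0 when the three points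
    are distinct. *)
Lemma mobius_cross_ratio (R : realType) (a b c d x0 x1 x2 x3 : R) :
  let y x := mobius a b c d x in let l x := c * x + d in
  l x0 != 0 -> l x1 != 0 -> l x2 != 0 -> l x3 != 0 ->
  let U := cross_left R (y x0) x2 x3 (y x1) (y x2) (y x3) in
  let V := cross_left R (y x0) x1 x3 (y x2) (y x1) (y x3) in
  x0 * (U - V) = x1 * U - x2 * V /\
  U - V = (a * d - b * c) ^+ 2 * ((x1 - x2) * (x1 - x3) * (x2 - x3)) /
    (l x0 * l x1 * l x2 * l x3).
Proof.
rewrite /cross_left /mobius /= => l0 l1 l2 l3.
by split; field; rewrite l0 l1 l2 l3.
Qed.

(** Controls the replacement of the images y_i by nearby fractions z_i. The value y0 stays fixed,
    since M x0 is already rational in the application. *)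
Lemma cross_left_stable (R : realType) (B e y0 x2 x3 y1 y2 y3 z1 z2 z3 : R) :
  1 <= B -> e <= 1 -> `|x2| <= B -> `|x3| <= B ->
  `|y0| <= B -> `|y1| <= B -> `|y2| <= B -> `|y3| <= B ->
  `|y1 - z1| <= e -> `|y2 - z2| <= e -> `|y3 - z3| <= e ->
  `|cross_left R y0 x2 x3 z1 z2 z3 - cross_left R y0 x2 x3 y1 y2 y3|
     <= 16 * B ^+ 2 * e /\
  `|cross_left R y0 x2 x3 z1 z2 z3| <= 24 * B ^+ 3.
Proof.
move=> B1 e1 x2B x3B y0B y1B y2B y3B e_1 e_2 e_3.
have e0 : 0 <= e by apply: le_trans e_1.
rewrite /cross_left -mulrBr !normrM.
have xx : `|x2 - x3| <= 2 * B by apply: (le_trans (ler_normB _ _)); lra.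
have bz (y z : R) : `|y| <= B -> `|y - z| <= e -> `|z| <= 2 * B.
  by move=> *; have := ler_normB y (y - z); rewrite subKr; lra.
have z1B := bz _ _ y1B e_1; have z2B := bz _ _ y2B e_2.
have z3B := bz _ _ y3B e_3.
have u' : `|y0 - z2| <= 3 * B by apply: (le_trans (ler_normB _ _)); lra.
have v' : `|z1 - z3| <= 4 * B by apply: (le_trans (ler_normB _ _)); lra.
have v : `|y1 - y3| <= 2 * B by apply: (le_trans (ler_normB _ _)); lra.
have dv : `|(y1 - z1) - (y3 - z3)| <= 2 * e.
  by apply: (le_trans (ler_normB _ _)); lra.
split.
  have -> : (y0 - z2) * (z1 - z3) - (y0 - y2) * (y1 - y3) =
    (y2 - z2) * (y1 - y3) - (y0 - z2) * ((y1 - z1) - (y3 - z3)) by ring.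
  have H : `|(y2 - z2) * (y1 - y3) - (y0 - z2) * ((y1 - z1) - (y3 - z3))|
      <= e * (2 * B) + (3 * B) * (2 * e).
    apply: (le_trans (ler_normB _ _)); rewrite !normrM.
    by apply: lerD; apply: ler_pM.
  have -> : 16 * B ^+ 2 * e = (2 * B) * (e * (2 * B) + (3 * B) * (2 * e)) by ring.
  exact: ler_pM.
have -> : 24 * B ^+ 3 = (2 * B) * ((3 * B) * (4 * B)) by ring.
by apply: ler_pM => //; rewrite ?mulr_ge0 //; apply: ler_pM.
Qed.

(** The cross-ratio produces a denominator of unknown sign, so the sign is moved to the
    numerator. *)
Lemma irrationality_measure_int (R : realType) (x : R) (N : nat) :
  (forall (p : int) (q : nat), (2 <= q)%N -> q%:R ^- N <= `|x - p%:~R / q%:R|) ->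
  forall p q : int, (2 <= `|q|)%N -> `|q%:~R| ^- N <= `|x - p%:~R / q%:~R|.
Proof.
move=> H p [q|q] q2; first by rewrite normr_nat; apply: H.
rewrite NegzE rmorphN /= normrN normr_nat.
have -> : p%:~R / - q.+1%:R = (- p)%:~R / q.+1%:R :> R.
  by rewrite rmorphN /= invrN mulrN mulNr.
exact: H.
Qed.

Lemma exists_nat_ge (R : realType) (x : R) : exists n : nat, x <= n%:R.
Proof.
exists (Num.bound `|x|); apply: (le_trans (ler_norm x)).
exact/ltW/archi_boundP.
Qed.

Lemma intr_ge1 (R : realType) (n : int) : n != 0 -> 1 <= `|n%:~R| :> R.
Proof. by move=> n0; rewrite -intr_norm ler1z -gtz0_ge1 normr_gt0. Qed.

(* Three values M (p_i / Q) close to r_i / s_i would, through the cross-ratio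
   with x0 and M x0 = r0 / s0, yield a fraction p / q close to x0: with
   Q = T^4 and T <= S one gets q <= S^15 and |x0 - p / q| <= S^-(16 N + 3). *)
Lemma no_three_close_fractions (R : realType) (a b c d al be B mu x0 : R)
    (r0 : int) (s0 N : nat) :
  a * d - b * c != 0 -> 1 <= B ->
  (forall x, al <= x <= be -> [/\ c * x + d != 0, `|c * x + d| <= mu,
     `|x| <= B & `|mobius a b c d x| <= B]) ->
  al <= x0 <= be -> (0 < s0)%N -> mobius a b c d x0 = r0%:~R / s0%:R ->
  (forall (p : int) (q : nat), (2 <= q)%N ->
     q%:R ^- N <= `|x0 - p%:~R / q%:R|) ->
  exists K : nat, forall T S : nat, (K <= T)%N -> (T <= S)%N ->
  let close p := exists (r : int) (s : nat), (S <= s < S ^ 2)%N /\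
    `|mobius a b c d (p%:~R / T%:R ^+ 4) - r%:~R / s%:R|
       < 2 * s%:R ^- (16 * N + 16) in
  forall p1 p2 p3 : int, p1 != p2 -> p1 != p3 -> p2 != p3 ->
  al <= p1%:~R / T%:R ^+ 4 <= be -> al <= p2%:~R / T%:R ^+ 4 <= be ->
  al <= p3%:~R / T%:R ^+ 4 <= be ->
  close p1 -> close p2 -> ~ close p3.
Proof.
move=> hdet B1 HI Ix0 s0_gt0 Mx0 Hx0.
have [l0 l0mu x0B y0B] := HI _ Ix0.
have mu0 : 0 < mu by apply: lt_le_trans l0mu; rewrite normr_gt0.
pose om := (a * d - b * c) ^+ 2 / mu ^+ 4.
have om0 : 0 < om.
  apply: divr_gt0; last by rewrite exprn_gt0.
  by rewrite exprn_even_gt0.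
(* [k1] lets one factor S absorb the constants in the size of the denominator [q]; [k2] lets one
   factor S beat the perturbation constants relative to [om]. *)
have [k1 Hk1] := exists_nat_ge R (48 * B ^+ 3 * s0%:R).
have [k2 Hk2] := exists_nat_ge R (256 * B ^+ 3 / om).
exists (k1 + k2 + 2)%N => T S KT TS close p1 p2 p3 n12 n13 n23 I1 I2 I3.
move=> [r1 [s1 [/andP[Ss1 s1S] c1]]] [r2 [s2 [/andP[Ss2 s2S] c2]]].
move=> [r3 [s3 [/andP[Ss3 s3S] c3]]].
have T2 : (2 <= T)%N by clear -KT; lia.
set t := (T%:R : R) in I1 I2 I3 c1 c2 c3 *; set sg := (S%:R : R).
have tsg : t <= sg by rewrite ler_nat.
have t2 : 2 <= t by rewrite ler_nat.
have sgk1 : 48 * B ^+ 3 * s0%:R <= sg.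
  by apply: (le_trans Hk1); rewrite ler_nat; clear -KT TS; lia.
have sgk2 : 256 * B ^+ 3 / om <= sg.
  by apply: (le_trans Hk2); rewrite ler_nat; clear -KT TS; lia.
have sg2 : 2 <= sg by apply: le_trans tsg.
have sg0 : 0 < sg by lra.
have sg1 : 1 <= sg by lra.
set Q := t ^+ 4 in I1 I2 I3 c1 c2 c3 *.
have Q0 : 0 < Q by rewrite exprn_gt0 //; lra.
have QT : Q = (T ^ 4)%:R by rewrite /Q /t natrX.
have Qsg : Q <= sg ^+ 4 by rewrite lerXn2r ?nnegrE //; lra.
set e := 2 * sg ^- (16 * N + 16).
have close_e (s : nat) : (S <= s)%N -> 2 * s%:R ^- (16 * N + 16) <= e :> R.
  move=> Ss; rewrite ler_pM2l // lef_pV2 ?posrE ?exprn_gt0 //.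
    by rewrite lerXn2r ?nnegrE ?ler_nat // ltW.
  by apply: lt_le_trans sg0 _; rewrite ler_nat.
have e1 : e <= 1.
  rewrite /e ler_pdivrMr ?exprn_gt0 // mul1r; apply: (le_trans sg2).
  by rewrite -{1}(expr1 sg) ler_weXn2l //; clear; lia.
have {}c1 := ltW (lt_le_trans c1 (close_e _ Ss1)).
have {}c2 := ltW (lt_le_trans c2 (close_e _ Ss2)).
have {}c3 := ltW (lt_le_trans c3 (close_e _ Ss3)).
set x1 := _ / Q in I1 c1; set x2 := _ / Q in I2 c2; set x3 := _ / Q in I3 c3.
have [l1 l1mu x1B y1B] := HI _ I1; have [l2 l2mu x2B y2B] := HI _ I2.
have [l3 l3mu x3B y3B] := HI _ I3.
set y1 := mobius a b c d x1 in c1 y1B; set y2 := mobius a b c d x2 in c2 y2B.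
set y3 := mobius a b c d x3 in c3 y3B.
set z1 := _ / _ in c1; set z2 := _ / _ in c2; set z3 := _ / _ in c3.
set y0 := mobius a b c d x0 in Mx0 y0B.
have := mobius_cross_ratio R a b c d x0 x1 x2 x3 l0 l1 l2 l3.
rewrite -/y0 -/y1 -/y2 -/y3 /=.
set U := cross_left _ _ _ _ _ _ _; set V := cross_left _ _ _ _ _ _ _.
move=> [x0E UVE].
have [dU U'B] := cross_left_stable R B e y0 x2 x3 y1 y2 y3 z1 z2 z3
  B1 e1 x2B x3B y0B y1B y2B y3B c1 c2 c3.
have [dV V'B] := cross_left_stable R B e y0 x1 x3 y2 y1 y3 z2 z1 z3
  B1 e1 x1B x3B y0B y2B y1B y3B c2 c1 c3.
rewrite -/U in dU; rewrite -/V in dV.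
set U' := cross_left _ _ _ _ _ _ _ in dU U'B.
set V' := cross_left _ _ _ _ _ _ _ in dV V'B.
(* Distinct fractions over [Q] differ by at least 1 / Q, and U - V contains three such
   differences. *)
have UV_ge : om / Q ^+ 3 <= `|U - V|.
  rewrite UVE normrM normfV normrM (ger0_norm (sqr_ge0 _)) !normrM.
  have xd (p p' : int) : p != p' -> Q^-1 <= `|p%:~R / Q - p'%:~R / Q| :> R.
    move=> pp'; rewrite -mulrBl -rmorphB normrM normfV (gtr0_norm Q0).
    by rewrite ler_peMl ?invr_ge0 ?(ltW Q0) // intr_ge1 // subr_eq0.
  have := xd _ _ n12; have := xd _ _ n13; have := xd _ _ n23.
  rewrite -/x1 -/x2 -/x3 => d23 d13 d12.
  have Qi0 : 0 <= Q^-1 by rewrite invr_ge0 ltW.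
  have dd : Q ^- 3 <= `|x1 - x2| * `|x1 - x3| * `|x2 - x3|.
    by rewrite -exprVn 2!exprSr expr1; apply: ler_pM; rewrite ?mulr_ge0 //; apply: ler_pM.
  have ll : `|c * x0 + d| * `|c * x1 + d| * `|c * x2 + d| * `|c * x3 + d| <= mu ^+ 4.
    by rewrite 3!exprSr expr1; do 3![apply: ler_pM; rewrite ?mulr_ge0 //].
  rewrite /om -[leLHS]mulrA -[leRHS]mulrA ler_wpM2l ?sqr_ge0 //.
  rewrite [leRHS]mulrC ler_pM ?invr_ge0 ?exprn_ge0 ?(ltW mu0) ?(ltW Q0) //.
  rewrite lef_pV2 ?posrE ?exprn_gt0 // !mulr_gt0 ?normr_gt0 //.
have eQ : e * Q ^+ 3 <= 2 * sg ^- (16 * N + 4).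
  rewrite /e -mulrA ler_pM2l // ler_pdivrMl ?exprn_gt0 //.
  have -> : (16 * N + 16 = 12 + (16 * N + 4))%N by clear; lia.
  rewrite exprD mulfK ?expf_neq0 ?gt_eqF //.
  by rewrite -[12%N]/(4 * 3)%N exprM lerXn2r ?nnegrE ?exprn_ge0 // ltW.
set g := sg ^- (16 * N + 4) in eQ.
have g0 : 0 < g by rewrite invr_gt0 exprn_gt0.
have gsg : sg * g = sg ^- (16 * N + 3).
  rewrite /g addnS exprS invfM mulrA divff ?mul1r // gt_eqF //.
have g_le : sg * g <= 1.
  by rewrite gsg invf_le1 ?exprn_gt0 // exprn_ege1.
have e0 : 0 < e by rewrite mulr_gt0 // invr_gt0 exprn_gt0.
have B3 : 0 < B ^+ 3 by rewrite exprn_gt0 // (lt_le_trans ltr01 B1).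
have B23 : B ^+ 2 <= B ^+ 3 by rewrite ler_weXn2l.
have Q3 : 0 < Q ^+ 3 by rewrite exprn_gt0.
have omsg : 256 * B ^+ 3 <= sg * om by rewrite -ler_pdivrMr.
have omg : 256 * B ^+ 3 * g <= om.
  apply: (@le_trans _ _ (sg * om * g)); first by rewrite ler_pM2r.
  by rewrite mulrAC ler_piMl // ltW.
set W := U' - V'.
have dW : `|W - (U - V)| <= 32 * B ^+ 2 * e.
  have -> : W - (U - V) = (U' - U) - (V' - V) by rewrite /W; ring.
  by apply: (le_trans (ler_normB _ _)); clear -dU dV; lra.
(* The perturbation is at most half of the lower bound for U - V, so [W] is nonzero and can serve as
   a denominator. *)
have W_ge : om / Q ^+ 3 / 2 <= `|W|.
  have := lerB_dist (U - V) (U - V - W); rewrite subKr => H.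
  suff : 32 * B ^+ 2 * e <= om / Q ^+ 3 / 2 by rewrite distrC in dW; clear -H UV_ge dW; lra.
  rewrite ler_pdivlMr // ler_pdivlMr //.
  have : B ^+ 2 * (e * Q ^+ 3) <= B ^+ 3 * (2 * g).
    apply: ler_pM => //; first by apply: exprn_ge0; apply: le_trans B1.
    by apply: mulr_ge0; apply: ltW.
  by have := mulr_gt0 B3 g0; clear -omg; lra.
have W0 : 0 < `|W| by apply: lt_le_trans W_ge; do 2![apply: divr_gt0 => //].
have Wn0 : W != 0 by rewrite -normr_gt0.
have dx (x : R) : `|x| <= B -> `|x0 - x| <= 2 * B.
  by move=> xB; apply: (le_trans (ler_normB _ _)); clear -x0B xB; lra.
have num : `|x0 * W - (x1 * U' - x2 * V')| <= 64 * B ^+ 3 * e.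
  have -> : x0 * W - (x1 * U' - x2 * V') =
     (x0 - x1) * (U' - U) - (x0 - x2) * (V' - V) +
     (x0 * (U - V) - (x1 * U - x2 * V)) by rewrite /W; ring.
  rewrite x0E subrr addr0; apply: (le_trans (ler_normB _ _)); rewrite !normrM.
  have -> : 64 * B ^+ 3 * e = 2 * B * (16 * B ^+ 2 * e) + 2 * B * (16 * B ^+ 2 * e)
    by ring.
  by apply: lerD; apply: ler_pM => //; apply: dx.
have near_x0 : `|x0 - (x1 * U' - x2 * V') / W| <= sg ^- (16 * N + 3).
  have -> : x0 - (x1 * U' - x2 * V') / W = (x0 * W - (x1 * U' - x2 * V')) / W.
    by field.
  rewrite normrM normfV ler_pdivrMr // -gsg; apply: (le_trans num).
  apply: (@le_trans _ _ (sg * g * (om / Q ^+ 3 / 2))); last first.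
    by rewrite ler_pM2l // mulr_gt0.
  rewrite [leRHS]mulrA ler_pdivlMr // [leRHS]mulrA ler_pdivlMr //.
  have : B ^+ 3 * (e * Q ^+ 3) <= B ^+ 3 * (2 * g) by rewrite ler_pM2l.
  have : 256 * B ^+ 3 * g <= sg * om * g by rewrite ler_pM2r.
  by have := mulr_gt0 B3 g0; clear; lra.
have nS (s : nat) : (S <= s)%N -> s%:R != 0 :> R.
  by move=> Ss; rewrite gt_eqF // (lt_le_trans sg0) // ler_nat.
have s0n : s0%:R != 0 :> R by rewrite pnatr_eq0 -lt0n.
have s1n := nS _ Ss1; have s2n := nS _ Ss2; have s3n := nS _ Ss3.
have Qn : Q != 0 by rewrite gt_eqF.
(* The factor [F] clears the denominators of [U'] and [V']. A second factor [Q], in [q], clears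
   those of [x1] and [x2]. *)
pose U2 := (p2 - p3) * ((r0 * s2%:Z - r2 * s0%:Z) * (r1 * s3%:Z - r3 * s1%:Z)).
pose V2 := (p1 - p3) * ((r0 * s1%:Z - r1 * s0%:Z) * (r2 * s3%:Z - r3 * s2%:Z)).
pose F := Q * (s0%:R * s1%:R * s2%:R * s3%:R).
have U2E : U2%:~R = F * U'.
  rewrite /U2 /U' /cross_left Mx0 /F /x2 /x3 /z1 /z2 /z3.
  rewrite !(rmorphM, rmorphB) /=.
  by field; rewrite Qn s0n s1n s2n s3n.
have V2E : V2%:~R = F * V'.
  rewrite /V2 /V' /cross_left Mx0 /F /x1 /x3 /z1 /z2 /z3.
  rewrite !(rmorphM, rmorphB) /=.
  by field; rewrite Qn s0n s1n s2n s3n.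
pose q : int := (T ^ 4)%:Z * (U2 - V2).
have qE : q%:~R = Q * F * W.
  have QZ : (T ^ 4)%:Z%:~R = Q by rewrite QT.
  by rewrite /q intrM intrB QZ U2E V2E /W; ring.
have Fn : F != 0 by rewrite /F; do 4![apply: mulf_neq0 => //].
have UV2 : U2 - V2 != 0.
  by rewrite -(intr_eq0 R) rmorphB /= U2E V2E -mulrBr mulf_neq0.
have q2 : (2 <= `|q|)%N.
  rewrite abszM (leq_trans T2) // -[leqLHS]muln1 leq_mul ?absz_gt0 //.
  by rewrite -[leqLHS]expn1 leq_pexp2l // ltnW.
have := irrationality_measure_int R x0 N Hx0 (p1 * U2 - p2 * V2) q q2.
have -> : (p1 * U2 - p2 * V2)%:~R / q%:~R = (x1 * U' - x2 * V') / W :> R.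
  have -> : (p1 * U2 - p2 * V2)%:~R = p1%:~R * (F * U') - p2%:~R * (F * V') :> R.
    by rewrite -U2E -V2E intrB; congr (_ - _); rewrite intrM.
  rewrite qE /x1 /x2.
  by field; rewrite Fn Qn Wn0.
move=> H; have := le_trans H near_x0; apply/negP; rewrite -ltNge.
have W_le : `|W| <= 48 * B ^+ 3.
  by apply: (le_trans (ler_normB _ _)); clear -U'B V'B; lra.
(* The exponent is 8 from two factors [Q], 6 from [s1], [s2], [s3], and 1 from [s0] times [W]. The
   bound S^-(15 N) obtained for the distance to [x0] exceeds S^-(16 N + 3). *)
have q_le : `|q%:~R| <= sg ^+ 15 :> R.
  have Qg := ltW Q0.
  have F0 : 0 <= F by rewrite /F; do 4![apply: mulr_ge0 => //].
  rewrite qE normrM (ger0_norm (mulr_ge0 Qg F0)) /F.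
  have sB (s : nat) : (s < S ^ 2)%N -> s%:R <= sg ^+ 2.
    by move=> sS; rewrite -natrX ler_nat ltnW.
  have -> : Q * (Q * (s0%:R * s1%:R * s2%:R * s3%:R)) * `|W| =
    Q * Q * (s1%:R * s2%:R * s3%:R) * (`|W| * s0%:R) by ring.
  have -> : sg ^+ 15 = sg ^+ 4 * sg ^+ 4 * (sg ^+ 2 * sg ^+ 2 * sg ^+ 2) * sg by ring.
  apply: ler_pM; rewrite ?mulr_ge0 //.
    apply: ler_pM; rewrite ?mulr_ge0 //; first by apply: ler_pM.
    by apply: ler_pM; rewrite ?mulr_ge0 ?sB //; apply: ler_pM; rewrite ?sB.
  by apply: le_trans sgk1; rewrite ler_wpM2r.
have q_gt0 : 0 < `|q%:~R| :> R.
  by rewrite normr_gt0 qE; do 2![apply: mulf_neq0 => //].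
apply: (@lt_le_trans _ _ (sg ^- (15 * N))).
  rewrite ltf_pV2 ?posrE ?exprn_gt0 // ltr_eXn2l; first by clear; lia.
  by apply: lt_le_trans sg2; rewrite ltr1n.
rewrite lef_pV2 ?posrE ?exprn_gt0 // exprM.
by rewrite lerXn2r ?nnegrE // ?exprn_ge0 // ltW.
Qed.

(** * Selection of numerators and shrinking of windows *)

(** Each condition removes at most two elements, so more than 2 L elements leave a survivor. *)
Lemma exists_avoiding (X : eqType) (bad : nat -> X -> Prop) (L : nat) (s : seq X) :
  uniq s -> (2 * L < size s)%N ->
  (forall j, (j < L)%N -> forall x y z, x \in s -> y \in s -> z \in s ->
     x != y -> x != z -> y != z -> bad j x -> bad j y -> ~ bad j z) ->
  exists2 x, x \in s & forall j, (j < L)%N -> ~ bad j x.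
Proof.
elim: L s => [|L IHL] s us Ls Hs.
  by case: s us Ls Hs => [|x s] //= _ _ _; exists x; rewrite // inE eqxx.
pose g := [seq x <- s | ~~ `[< bad L x >]].
have sizeg : (size s <= 2 + size g)%N.
  rewrite -(count_predC (fun x => `[< bad L x >]) s) size_filter leq_add2r.
  rewrite -size_filter leqNgt; apply/negP.
  have : uniq [seq x <- s | `[< bad L x >]] by rewrite filter_uniq.
  have : forall x, x \in [seq x <- s | `[< bad L x >]] -> x \in s /\ bad L x.
    by move=> x; rewrite mem_filter => /andP[/asboolP].
  case: [seq x <- s | _] => [|x [|y [|z u]]] //= Hin.
  rewrite !inE !negb_or => /andP[/and3P[xy xz _] /andP[/andP[yz _] _]] _.
  have [xs bx] := Hin x (mem_head _ _).
  have [ys by_] : y \in s /\ bad L y by apply: Hin; rewrite !inE eqxx orbT.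
  have [zs bz] : z \in s /\ bad L z by apply: Hin; rewrite !inE eqxx !orbT.
  exact: (Hs L (ltnSn L) x y z).
have [||j jL x y z|x] := IHL g.
- exact: filter_uniq.
- by move: Ls sizeg; lia.
- rewrite !mem_filter => /andP[_ xs] /andP[_ ys] /andP[_ zs].
  by apply: Hs => //; apply: ltnW.
rewrite mem_filter => /andP[/asboolPn nbx xs] Hx; exists x => // j.
by rewrite ltnS leq_eqVlt => /orP[/eqP->|/Hx].
Qed.

(** Only [k] ranges are needed to reach T^(2^k), so at most 2 k numerators are lost. *)
Lemma exists_doubling_scale (T s k : nat) : (T <= s)%N -> (s < T ^ (2 ^ k))%N ->
  exists2 j, (j < k)%N & (T ^ (2 ^ j) <= s < (T ^ (2 ^ j)) ^ 2)%N.
Proof.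
move=> Ts; elim: k => [|k IHk]; first by rewrite expn0 expn1 ltnNge Ts.
case: (ltnP s (T ^ (2 ^ k))) => [/IHk[j jk Hj] _|H1 H2].
  by exists j => //; apply: ltnW.
by exists k => //; rewrite H1 -expnM -expnSr.
Qed.

(* Two fractions with denominators below T are at least T^-2 apart, so the
   image of a window of length kap / T^2 meets at most one of them. *)
Lemma window_avoiding_fractions (R : realType) (f : R -> R)
    (al be lo hi kap : R) (m : nat) :
  0 < lo -> 0 < kap -> hi * kap <= 2^-1 ->
  (forall x y, al <= x <= be -> al <= y <= be ->
     lo * `|x - y| <= `|f x - f y| <= hi * `|x - y|) ->
  exists K : nat, forall (T : nat) (u : R), (K <= T)%N ->
  al <= u -> u + kap / T%:R ^+ 2 <= be ->
  exists2 u' : R, u <= u' <= u + 2 / 3 * (kap / T%:R ^+ 2) &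
    forall x, u' <= x <= u' + (kap / T%:R ^+ 2) / 3 ->
    forall (r : int) (s : nat), (s < T)%N -> (T <= s ^ m)%N ->
    s%:R ^- (3 * m) <= `|f x - r%:~R / s%:R|.
Proof.
move=> lo0 kap0 hik fL.
have [k Hk] := exists_nat_ge R (6 / (lo * kap)).
exists (k + 5)%N => T u KT alu ube.
have T5 : 5 <= T%:R :> R by rewrite ler_nat; lia.
set t := (T%:R : R) in T5 ube *; have t0 : 0 < t by lra.
have tk : 6 < lo * kap * t.
  rewrite mulrC -ltr_pdivrMr ?mulr_gt0 //; apply: (le_lt_trans Hk).
  by rewrite ltr_nat; lia.
set w := kap / t ^+ 2 in ube *.
have w0 : 0 < w by rewrite divr_gt0 ?exprn_gt0.
(* Either the first third of the window is free of close fractions, or it contains a point x near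
   some r / s, and then the last third is free. *)
have [H|/existsNP[x /not_implyP[xl /existsNP[r /existsNP[s /not_implyP[sT
  /not_implyP[Ts /negP]]]]]]] :=
  pselect (forall x, u <= x <= u + w / 3 -> forall (r : int) (s : nat),
    (s < T)%N -> (T <= s ^ m)%N -> s%:R ^- (3 * m) <= `|f x - r%:~R / s%:R|).
  by exists u => //; apply/andP; split; lra.
rewrite -ltNge => xr.
exists (u + 2 / 3 * w); first by apply/andP; split; lra.
move=> x' x'l r' s' s'T Ts'; rewrite leNgt; apply/negP => xr'.
have small (q : nat) : (T <= q ^ m)%N -> q%:R ^- (3 * m) <= t ^- 3.
  move=> Tq; have t1 : t <= q%:R ^+ m by rewrite -natrX ler_nat.
  have qm0 := lt_le_trans t0 t1.
  rewrite mulnC exprM lef_pV2 ?posrE ?(exprn_gt0 3) //.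
  by rewrite lerXn2r ?nnegrE // ltW.
have {}xr := lt_le_trans xr (small _ Ts).
have {}xr' := lt_le_trans xr' (small _ Ts').
have pos (q : nat) : (T <= q ^ m)%N -> (0 < q)%N.
  move=> Tq; rewrite lt0n; apply/eqP => q0; move: Tq; rewrite q0.
  by case: (posnP m) => [->|m0]; rewrite ?expn0 ?exp0n //; clear -KT; lia.
have s0 := pos _ Ts; have s'0 := pos _ Ts'.
have /andP[lofx fxhi] : lo * `|x' - x| <= `|f x' - f x| <= hi * `|x' - x|.
  by apply: fL; apply/andP; split; lra.
have xx'l : w / 3 <= `|x' - x| by rewrite ger0_norm; lra.
have xx'h : `|x' - x| <= w by rewrite ger0_norm; lra.
have t3 : t ^- 3 = t^-1 * t ^- 2 by rewrite -!exprVn -exprS.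
have ti : 0 < t ^- 2 by rewrite invr_gt0 exprn_gt0.
have t_inv : t^-1 <= 5^-1 by rewrite lef_pV2 ?posrE.
have ff : `|f x' - f x| <= t ^- 2 / 2.
  apply: (le_trans fxhi); apply: (@le_trans _ _ (hi * w)).
    by rewrite ler_wpM2l // leNgt; apply/negP => hi0; move: lofx fxhi; nra.
  by rewrite /w mulrA [leRHS]mulrC ler_pM2r.
(* If the two fractions agree, the lower Lipschitz bound across the middle third is violated. If
   they differ, they are T^-2 apart, while only 1/2 + 2/5 of T^-2 is available. *)
have [rr|rr] := eqVneq (r%:~R / s%:R : R) (r'%:~R / s'%:R).
  have : `|f x' - f x| < 2 * t ^- 3.
    have -> : f x' - f x = (f x' - r'%:~R / s'%:R) - (f x - r%:~R / s%:R).
      by rewrite rr; ring.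
    by apply: (le_lt_trans (ler_normB _ _)); lra.
  move=> H; have : lo * (w / 3) < 2 * t ^- 3 by apply: le_lt_trans H; nra.
  rewrite t3 /w -/(t ^- 2) => H2.
  have : lo * (kap * t ^- 2 / 3) * t < 2 * (t^-1 * t ^- 2) * t by rewrite ltr_pM2r.
  have -> : 2 * (t^-1 * t ^- 2) * t = 2 * t ^- 2 by field; rewrite gt_eqF.
  nra.
have : t ^- 2 <= `|r%:~R / s%:R - r'%:~R / s'%:R|.
  have -> : r%:~R / s%:R - r'%:~R / s'%:R =
      (r * s'%:Z - r' * s%:Z)%:~R / (s%:R * s'%:R) :> R.
    by rewrite rmorphB !rmorphM /=; field; rewrite !pnatr_eq0 -!lt0n s0 s'0.
  rewrite normrM normfV [`|_ * _|]ger0_norm ?mulr_ge0 //.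
  apply: (@le_trans _ _ (s%:R * s'%:R)^-1).
    have ss0 : 0 < s%:R * s'%:R :> R by rewrite mulr_gt0 ?ltr0n.
    have t20 : 0 < t ^+ 2 by rewrite exprn_gt0.
    rewrite lef_pV2 ?posrE // expr2.
    by rewrite ler_pM // ler_nat ltnW.
  rewrite ler_peMl ?invr_ge0 ?mulr_ge0 // intr_ge1 //.
  apply: contra_neq rr => E.
  have : r%:~R * s'%:R = r'%:~R * s%:R :> R.
    apply/eqP; rewrite -subr_eq0; apply/eqP.
    by have := congr1 (fun z : int => z%:~R : R) E; rewrite rmorphB !rmorphM /=.
  by move=> E2; apply/eqP; rewrite eqr_div ?pnatr_eq0 -?lt0n // E2.
apply/negP; rewrite -ltNge.
have -> : r%:~R / s%:R - r'%:~R / s'%:R =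
  (f x' - r'%:~R / s'%:R) - (f x - r%:~R / s%:R) - (f x' - f x) by ring.
apply: (le_lt_trans (ler_normB _ _)).
apply: (@le_lt_trans _ _ (`|f x' - r'%:~R / s'%:R| + `|f x - r%:~R / s%:R| +
  `|f x' - f x|)).
  by rewrite lerD2r ler_normB.
by rewrite t3 in xr xr'; nra.
Qed.

(** Combines the three-fraction obstruction on each range with the counting argument. The exponent
    16 N + 16 is written as 2 m with m = 8 N + 8, as the window step requires. *)
Lemma exists_badly_approximable_image (R : realType)
    (a b c d al be B mu x0 : R) (r0 : int) (s0 N : nat) :
  a * d - b * c != 0 -> 1 <= B ->
  (forall x, al <= x <= be -> [/\ c * x + d != 0, `|c * x + d| <= mu,
     `|x| <= B & `|mobius a b c d x| <= B]) ->
  al <= x0 <= be -> (0 < s0)%N -> mobius a b c d x0 = r0%:~R / s0%:R ->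
  (forall (p : int) (q : nat), (2 <= q)%N ->
     q%:R ^- N <= `|x0 - p%:~R / q%:R|) ->
  exists K : nat, forall (T k : nat) (ps : seq int), (K <= T)%N ->
  uniq ps -> (2 * k < size ps)%N ->
  (forall p, p \in ps -> al <= p%:~R / T%:R ^+ 4 <= be) ->
  exists2 p, p \in ps & forall (r : int) (s : nat), (T <= s)%N ->
    (s < T ^ (2 ^ k))%N -> 2 * s%:R ^- (2 * (8 * N + 8)) <=
      `|mobius a b c d (p%:~R / T%:R ^+ 4) - r%:~R / s%:R|.
Proof.
move=> hdet B1 HI Ix0 s0_gt0 Mx0 Hx0.
have [K HK] := no_three_close_fractions R a b c d al be B mu x0 r0 s0 N
  hdet B1 HI Ix0 s0_gt0 Mx0 Hx0.
exists K.+1 => T k ps KT ups kps Ips.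
have [||j jk x y z /Ips Ix /Ips Iy /Ips Iz xy xz yz|p pps Hp] :=
  @exists_avoiding _ (fun j p => exists (r : int) (s : nat),
    (T ^ (2 ^ j) <= s < (T ^ (2 ^ j)) ^ 2)%N /\
    `|mobius a b c d (p%:~R / T%:R ^+ 4) - r%:~R / s%:R|
       < 2 * s%:R ^- (16 * N + 16)) k ps => //.
  apply: HK => //; first exact: ltnW.
  by rewrite -[leqLHS]expn1 leq_pexp2l ?expn_gt0 // (leq_trans _ KT).
exists p => // r s Ts sT; rewrite leNgt; apply/negP => close.
have [j jk Hj] := exists_doubling_scale T s k Ts sT.
apply: (Hp j jk); exists r, s; split=> //.
by have -> : (16 * N + 16 = 2 * (8 * N + 8))%N by lia.
Qed.

Lemma exists_fractions_in_window (R : realType) (u h : R) (Q n : nat) :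
  (0 < Q)%N -> n.+1%:R / Q%:R <= h ->
  exists ps : seq int, [/\ uniq ps, size ps = n.+1 &
    forall p, p \in ps -> u <= p%:~R / Q%:R <= u + h].
Proof.
move=> Q0 nh; have Q0R : 0 < Q%:R :> R by rewrite ltr0n.
exists [seq Num.ceil (u * Q%:R) + i%:Z | i <- iota 0 n.+1]; split.
- by rewrite map_inj_uniq ?iota_uniq // => i j /addrI [].
- by rewrite size_map size_iota.
move=> p /mapP[i]; rewrite mem_iota add0n => /andP[_ iln] ->.
rewrite rmorphD /= ler_pdivlMr // ler_pdivrMr //.
have up := ceil_ge (u * Q%:R); have down := ceilB1_lt (u * Q%:R).
rewrite ler_pdivrMr // in nh.
have i0 : 0 <= i%:R :> R by [].
have iN : i%:R + 1 <= n.+1%:R :> R by rewrite natr1 ler_nat.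
rewrite rmorphB /= in down.
by rewrite mulrDl; apply/andP; split; lra.
Qed.

(** A third of the window handles s < T, and p / T^4 chosen inside it handles T <= s < T^(2^k). The
    new window is so short that the lower bound survives on all of it. It begins strictly to the
    right of p / T^4, so its points never coincide with that fraction. *)
Lemma nested_window_step (R : realType) (f : R -> R) (al be hi kap : R) (m : nat) :
  (2 <= m)%N -> 0 < kap -> 0 <= hi -> hi * kap <= 2^-1 ->
  (forall x y, al <= x <= be -> al <= y <= be -> `|f x - f y| <= hi * `|x - y|) ->
  (exists K : nat, forall (T k : nat) (ps : seq int), (K <= T)%N ->
    uniq ps -> (2 * k < size ps)%N ->
    (forall p, p \in ps -> al <= p%:~R / T%:R ^+ 4 <= be) ->
    exists2 p, p \in ps & forall (r : int) (s : nat), (T <= s)%N ->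
      (s < T ^ (2 ^ k))%N ->
      2 * s%:R ^- (2 * m) <= `|f (p%:~R / T%:R ^+ 4) - r%:~R / s%:R|) ->
  (exists K : nat, forall (T : nat) (u : R), (K <= T)%N ->
    al <= u -> u + kap / T%:R ^+ 2 <= be ->
    exists2 u' : R, u <= u' <= u + 2 / 3 * (kap / T%:R ^+ 2) &
      forall x, u' <= x <= u' + (kap / T%:R ^+ 2) / 3 ->
      forall (r : int) (s : nat), (s < T)%N -> (T <= s ^ m)%N ->
      s%:R ^- (3 * m) <= `|f x - r%:~R / s%:R|) ->
  exists K : nat, forall (k T : nat) (u : R), (K <= T)%N -> (k <= T)%N ->
    al <= u -> u + kap / T%:R ^+ 2 <= be ->
    exists p : int, let T' := (T ^ (m * 2 ^ k))%N in
      let u' := p%:~R / T%:R ^+ 4 + kap / T'%:R ^+ 2 in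
      [/\ u <= u', u' + kap / T'%:R ^+ 2 <= u + kap / T%:R ^+ 2 &
        forall x, u' <= x <= u' + kap / T'%:R ^+ 2 ->
        forall (r : int) (s : nat), (T <= s ^ m)%N -> (s ^ m < T')%N ->
        s%:R ^- (3 * m) <= `|f x - r%:~R / s%:R|].
Proof.
move=> m2 kap0 hi0 hik fL [K1 H1] [K2 H2].
have [k3 Hk3] := exists_nat_ge R (24 / kap).
exists (K1 + K2 + k3 + 4)%N => k T u KT kT alu ube.
have T4 : (4 <= T)%N by clear -KT; lia.
have [|u' /andP[uu' u'u] Hu'] := H2 T u _ alu ube; first by clear -KT; lia.
have T'E : (T ^ 2 <= T ^ (m * 2 ^ k))%N.
  rewrite leq_pexp2l ?(leq_trans _ T4) //.
  by rewrite -[leqLHS]muln1 leq_mul // expn_gt0.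
set T' := (T ^ (m * 2 ^ k))%N in T'E *.
set t := (T%:R : R) in ube u'u Hu' *.
have t4 : 4 <= t by rewrite ler_nat.
have t0 : 0 < t by lra.
have t2 : 0 < t ^+ 2 by rewrite exprn_gt0.
set w := kap / t ^+ 2 in ube u'u Hu' *.
have w0 : 0 < w by rewrite divr_gt0.
set w' := kap / T'%:R ^+ 2.
have T'R : t ^+ 2 <= T'%:R :> R by rewrite -natrX ler_nat.
have T'0 : 0 < T'%:R :> R by apply: lt_le_trans T'R.
have w'0 : 0 < w' by rewrite divr_gt0 ?exprn_gt0.
(* The fraction lies in the first [w / 6] of the chosen third, and 1/6 + 2/16 < 1/3 keeps the new
   window inside it. *)
have w'w : w' <= w / 16.
  rewrite /w /w' -mulrA ler_pM2l // -invfM lef_pV2 ?posrE ?mulr_gt0 ?exprn_gt0 //.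
  apply: (@le_trans _ _ ((t ^+ 2) ^+ 2)); last first.
    by rewrite lerXn2r ?nnegrE ?(ltW t2) ?(ltW T'0).
  by rewrite [leRHS]expr2 ler_pM2l // expr2; nra.
(* There is room for 2 k + 1 numerators: the count needed is at most 2 T + 1, while [w / 6] contains
   at least 4 T steps of length T^-4. *)
have [||ps [ups sps Hps]] := exists_fractions_in_window R u' (w / 6) (T ^ 4) (2 * k).
- by rewrite expn_gt0 (leq_trans _ T4).
- rewrite natrX -/t ler_pdivrMr ?exprn_gt0 //.
  have -> : w / 6 * t ^+ 4 = kap * t * t / 6 by rewrite /w; field; rewrite gt_eqF.
  have kt : 24 <= kap * t.
    rewrite mulrC -ler_pdivrMr //; apply: (le_trans Hk3).
    by rewrite ler_nat; clear -KT; lia.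
  have kR : k%:R <= t by rewrite ler_nat.
  have -> : (2 * k).+1%:R = 2 * k%:R + 1 :> R by rewrite -natr1 natrM.
  by nra.
rewrite natrX -/t in Hps.
have [|||p pps Hp] := H1 T k ps _ ups _.
- by clear -KT; lia.
- by rewrite sps.
- move=> p /Hps /andP[? ?]; rewrite -/t; apply/andP; split; lra.
have /andP[pl pr] := Hps _ pps; rewrite -/t in Hp.
exists p => /=; rewrite -/w'; set x0 := _ / _ in Hp pl pr *; split; [lra|lra|].
move=> x /andP[xl xr] r s Ts; rewrite /T' mulnC expnM ltn_exp2r; last by clear -m2; lia.
move=> sT; have [sT1|Ts1] := ltnP s T.
  by apply: Hu' => //; apply/andP; split; lra.
have s1 : 1 <= s%:R :> R by rewrite ler1n; apply: leq_trans Ts1; clear -T4; lia.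
have s0 : 0 < s%:R :> R by lra.
(* T'^2 is the power of exponent 2 m of T^(2^k), so [f] moves by at most half of the margin in
   [Hp]. *)
have dev : `|f x - f x0| <= s%:R ^- (2 * m).
  apply: (@le_trans _ _ (hi * (2 * w'))).
    apply: (le_trans (fL _ _ _ _)); rewrite ?ler_wpM2l //.
    - by apply/andP; split; lra.
    - by apply/andP; split; lra.
    - by rewrite ger0_norm; lra.
  apply: (@le_trans _ _ (T'%:R ^- 2)).
    rewrite /w'; have : 0 < T'%:R ^- 2 :> R by rewrite invr_gt0 exprn_gt0.
    by set z := T'%:R ^- 2 => z0; nra.
  rewrite lef_pV2 ?posrE ?exprn_gt0 // -natrX -natrX ler_nat.
  have -> : (T' ^ 2 = (T ^ (2 ^ k)) ^ (2 * m))%N.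
    by rewrite /T' -!expnM mulnC mulnA mulnC.
  have m0 : (0 < 2 * m)%N by clear -m2; lia.
  by rewrite (leq_exp2r _ _ m0) (ltnW sT).
have := Hp r s Ts1 sT.
have -> : f x0 - r%:~R / s%:R = (f x - r%:~R / s%:R) - (f x - f x0) by ring.
move=> H; have := le_trans H (ler_normB _ _).
suff : s%:R ^- (3 * m) <= s%:R ^- (2 * m) :> R by lra.
by rewrite lef_pV2 ?posrE ?exprn_gt0 // ler_weXn2l // leq_mul2r orbT.
Qed.

(** * The limit of the nested windows *)

(** Expanding r / s by [T] brings every fraction into the range of the hypothesis. The cost is a
    constant factor, absorbed by a larger power of s. *)
Lemma not_liouville_of_large_denominators (R : realType) (y : R) (T m : nat) :
  (0 < T)%N -> (0 < m)%N ->
  (forall (r : int) (s : nat), (T <= s ^ m)%N ->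
     s%:R ^- (3 * m) <= `|y - r%:~R / s%:R|) ->
  ~ liouville y.
Proof.
move=> T0 m0 Hy /liouvilleP yL.
have [h Hh] := exists_expn_ge R T%:R.
have [r [s [s2 /andP[_ rs]]]] := yL (h.+1 * (3 * m))%N.
have s2R : 2 <= s%:R :> R by rewrite ler_nat.
have s0 : 0 < s%:R :> R by lra.
have T0R : 0 < T%:R :> R by rewrite ltr0n.
have := Hy (r * T%:Z) (s * T)%N.
have -> : (r * T%:Z)%:~R / (s * T)%:R = r%:~R / s%:R :> R.
  by rewrite natrM rmorphM /=; field; rewrite !gt_eqF.
have -> : (T <= (s * T) ^ m)%N.
  rewrite -[leqLHS]expn1; apply: (@leq_trans ((s * T) ^ 1)).
    by rewrite leq_exp2r // leq_pmull // ltnW.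
  by rewrite leq_pexp2l // muln_gt0 T0 ltnW.
move=> /(_ isT) /le_lt_trans /(_ rs); apply/negP; rewrite -leNgt.
rewrite lef_pV2 ?posrE ?exprn_gt0 // ?ltr0n ?muln_gt0 ?T0 ?(ltnW s2) //.
rewrite (exprM _ h.+1) lerXn2r ?nnegrE ?exprn_ge0 ?ler0n //.
rewrite natrM exprS ler_pM2l //; apply: (le_trans Hh).
by rewrite lerXn2r ?nnegrE.
Qed.

(** The exponent grows with the step, so that the centres p / T^4 approximate the limit to every
    order. *)
Fixpoint window_scale (m T0 k : nat) : nat :=
  if k is k'.+1 then (window_scale m T0 k' ^ (m * 2 ^ k'))%N else T0.

(** The summand [k] supplies the condition k <= T of the window step and makes the scales
    unbounded. *)
Lemma window_scale_ge (m T0 k : nat) : (2 <= m)%N -> (2 <= T0)%N ->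
  (T0 + k <= window_scale m T0 k)%N.
Proof.
move=> m2 T2; elim: k => [|k IHk] /=; first by rewrite addn0.
set T := window_scale m T0 k in IHk *.
apply: (@leq_trans (T ^ 2)); first by rewrite -mulnn; nia.
rewrite leq_pexp2l //; first by lia.
by rewrite -[leqLHS]muln1 leq_mul // expn_gt0.
Qed.

(** The windows shrink fast enough to make their common point Liouville, and the ranges between
    consecutive scales cover every s^m >= T0, which bounds the approximations of its image. *)
Lemma exists_liouville_nested (R : realType) (f : R -> R) (al be kap : R) (m : nat) :
  (2 <= m)%N -> al < be -> 0 < kap -> kap <= 2^-1 ->
  (exists K : nat, forall (k T : nat) (u : R), (K <= T)%N -> (k <= T)%N ->
    al <= u -> u + kap / T%:R ^+ 2 <= be ->
    exists p : int, let T' := (T ^ (m * 2 ^ k))%N in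
      let u' := p%:~R / T%:R ^+ 4 + kap / T'%:R ^+ 2 in
      [/\ u <= u', u' + kap / T'%:R ^+ 2 <= u + kap / T%:R ^+ 2 &
        forall x, u' <= x <= u' + kap / T'%:R ^+ 2 ->
        forall (r : int) (s : nat), (T <= s ^ m)%N -> (s ^ m < T')%N ->
        s%:R ^- (3 * m) <= `|f x - r%:~R / s%:R|]) ->
  exists xi : R, [/\ al <= xi <= be, liouville xi & ~ liouville (f xi)].
Proof.
move=> m2 albe kap0 kap1 [K HK].
have [k0 Hk0] := exists_nat_ge R (be - al)^-1.
pose T0 := (K + k0 + 2)%N; pose T := window_scale m T0.
have Tge k : (T0 + k <= T k)%N by apply: window_scale_ge => //; rewrite /T0; lia.
pose w k : R := kap / (T k)%:R ^+ 2.
have Tpos k : 0 < (T k)%:R :> R.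
  by rewrite ltr0n; have := Tge k; rewrite /T0; clear; lia.
have w0 k : 0 < w k by rewrite divr_gt0 ?exprn_gt0.
pose good (ku : nat * R) (p : int) :=
  let: (k, u) := ku in
  let u' := p%:~R / (T k)%:R ^+ 4 + w k.+1 in
  [/\ u <= u', u' + w k.+1 <= u + w k &
    forall x, u' <= x <= u' + w k.+1 ->
    forall (r : int) (s : nat), (T k <= s ^ m)%N -> (s ^ m < T k.+1)%N ->
    s%:R ^- (3 * m) <= `|f x - r%:~R / s%:R|].
have /choice[P HP] : forall ku : nat * R, exists p : int,
    al <= ku.2 -> ku.2 + w ku.1 <= be -> good ku p.
  move=> [k u] /=; have [h|h] := pselect (al <= u /\ u + w k <= be); last first.
    (* The value 0 is a placeholder for windows that leave [al, be]; [inv] shows that the recursion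
       never meets one. *)
    by exists 0 => *; exfalso; apply: h.
  have [p Hp] : exists p, good (k, u) p.
    by have := Tge k; rewrite /T0 => Tk; apply: HK; rewrite ?h.1 ?h.2 //; clear -Tk; lia.
  by exists p.
pose fix u k : R :=
  if k is k'.+1 then (P (k', u k'))%:~R / (T k')%:R ^+ 4 + w k'.+1 else al.
have inv k : al <= u k /\ u k + w k <= be.
  elim: k => [|k [alu ube]].
    split=> //=; rewrite -lerBrDl /w ler_pdivrMr ?exprn_gt0 //.
    have T1 : 1 <= T0%:R :> R by rewrite ler1n /T0; clear; lia.
    have : 1 <= (be - al) * T0%:R.
      rewrite mulrC -ler_pdivrMr ?subr_gt0 // div1r; apply: (le_trans Hk0).
      by rewrite ler_nat /T0; clear; lia.
    by rewrite expr2 mulrA /T /=; nra.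
  have [h1 h2 _] := HP (k, u k) alu ube; split; first exact: le_trans h1.
  exact: le_trans h2 ube.
have goodk k : good (k, u k) (P (k, u k)).
  by exact: (HP (k, u k) (inv k).1 (inv k).2).
have umono : {homo u : i j / (i <= j)%N >-> i <= j}.
  apply: homo_leq => //; [exact: le_trans|by move=> k; have [] := goodk k].
have vmono : {homo (fun k => u k + w k) : i j / (i <= j)%N >-> j <= i}.
  apply: homo_leq => //; first by move=> ? ? ? h1 h2; exact: le_trans h2 h1.
  by move=> k; have [] := goodk k.
have uv i j : u i <= u j + w j.
  apply: (@le_trans _ _ (u (maxn i j) + w (maxn i j))).
    by apply: (le_trans (umono _ _ (leq_maxl i j))); rewrite lerDl ltW.
  exact: (vmono _ _ (leq_maxr i j)).
have hs : has_sup (range u).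
  by split; [exists (u 0%N), 0%N|exists (u 0%N + w 0%N) => _ [k _ <-]].
pose xi := sup (range u).
have xil k : u k <= xi by apply: sup_upper_bound => //; exists k.
have xir k : xi <= u k + w k.
  by apply: ge_sup; [exists (u 0%N), 0%N|move=> _ [j _ <-]].
exists xi; split.
- by rewrite (xil 0%N) /=; have [_] := inv 0%N; apply: le_trans.
- apply/liouvilleP => N; exists (P (N, u N)), (T N ^ 4)%N.
  have T2 : (2 <= T N)%N by have := Tge N; rewrite /T0; clear; lia.
  split; first by rewrite (leq_trans T2) // -[leqLHS]expn1 leq_pexp2l // ltnW.
  have := xil N.+1; have := xir N.+1; rewrite /= natrX.
  have := w0 N.+1; set x := _ / _ => w1 xr xl.
  (* The offset of the window from its fraction gives the strict inequality required of a Liouville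
     approximation. *)
  have xlt : 0 < xi - x by lra.
  rewrite normr_gt0 (gt_eqF xlt) (gtr0_norm xlt) /=.
  apply: (@le_lt_trans _ _ (2 * w N.+1)); first by lra.
  apply: (@le_lt_trans _ _ ((T N.+1)%:R ^- 2)).
    rewrite /w; have : 0 < (T N.+1)%:R ^- 2 :> R by rewrite invr_gt0 exprn_gt0.
    by set z := (T N.+1)%:R ^- 2 => z0; nra.
  (* The comparison reduces to 4 N < 2 m 2^N, which follows from m >= 2 and N < 2^N. *)
  rewrite ltf_pV2 ?posrE ?exprn_gt0 // -!natrX ltr_nat /= -!expnM ltn_exp2l //.
  by have := ltn_expl N (ltnSn 1); clear -m2; nia.
- apply: (@not_liouville_of_large_denominators _ _ T0 m) => [||r s Ts].
  + by rewrite /T0; clear; lia.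
  + by clear -m2; lia.
  have [k /andP[k1 k2]] : exists k, (T k <= s ^ m < T k.+1)%N.
    have ex : exists k, (s ^ m < T k)%N.
      by exists (s ^ m)%N; have := Tge (s ^ m)%N; rewrite /T0; clear; lia.
    case: (ex_minnP ex) => -[|k] sk kmin; first by move: sk; rewrite /T /= ltnNge Ts.
    by exists k; rewrite sk andbT leqNgt; apply/negP => /kmin; rewrite ltnn.
  have [_ _ H] := goodk k; apply: H k1 k2.
  by rewrite (xil k.+1) (xir k.+1).
Qed.

(** * The base point and the window around it *)

Lemma affine_continuous (R : realType) (u v : R) :
  continuous (fun x : R => u * x + v).
Proof.
by move=> x; apply: cvgD; [apply: cvgM; [exact: cvg_cst|exact: cvg_id]|exact: cvg_cst].
Qed.

(** The inverse map is continuous at an image point, so it carries nearby rationals into [I]. If all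
    these preimages were rational, three of them would force rational coefficients. *)
Lemma exists_irrational_with_rational_image (R : realType) (a b c d : R)
    (I : set R) :
  a * d - b * c != 0 -> ~ int_proportional R a b c d ->
  open I -> I !=set0 -> I `<=` mobius_dom c d ->
  exists (x : R) (y : rat),
    [/\ I x, mobius a b c d x = ratr y & forall z : rat, x <> ratr z].
Proof.
move=> hdet nprop oI [x Ix] Idom; apply: contrapT => nex.
have lx : c * x + d != 0 by exact: Idom.
set y := mobius a b c d x.
(* The adjugate matrix gives the inverse map. *)
pose g z := mobius d (- b) (- c) a z.
have ayE : - c * y + a = (a * d - b * c) / (c * x + d).
  by rewrite /y /mobius; field.
have ay : - c * y + a != 0 by rewrite ayE mulf_neq0 ?invr_eq0.
have gy : g y = x.
  by rewrite /g /mobius ayE /y /mobius; field; rewrite hdet lx.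
have g_cont : {for y, continuous g}.
  apply: continuousM; first exact: affine_continuous.
  by apply: continuousV => //; exact: affine_continuous.
have nI : \forall z \near y, I (g z).
  by apply: g_cont; rewrite gy; apply: open_nbhs_nbhs.
have nd : \forall z \near y, - c * z + a != 0.
  have := affine_continuous R (- c) a y; move/(_ (fun r => r != 0)); apply.
  exact: open_nbhs_nbhs.
have /nbhs_ballP[e /= e0 He] : \forall z \near y, I (g z) /\ - c * z + a != 0.
  by near=> z; split; near: z.
have val (q : rat) : y < ratr q -> ratr q < y + e -> exists z : rat,
    c * ratr z + d != 0 /\ mobius a b c d (ratr z) = ratr q.
  move=> yq qe; have [Ig nz] : I (g (ratr q)) /\ - c * ratr q + a != 0.
    by apply: He; rewrite /ball /= ltr0_norm; lra.
  have lg : c * g (ratr q) + d != 0 by exact: Idom.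
  have Mg : mobius a b c d (g (ratr q)) = ratr q.
    have E : c * g (ratr q) + d = (a * d - b * c) / (- c * ratr q + a).
      by rewrite /g /mobius; field.
    rewrite /mobius E /g /mobius; field; rewrite nz hdet //.
  apply: contrapT => nz'; apply: nex; exists (g (ratr q)), q; split=> // z gz.
  by apply: nz'; exists z; rewrite -gz.
have rin (u v : R) : u < v -> exists q : rat, u < ratr q < v.
  by move=> /rat_in_itvoo[q]; rewrite in_itv /=; exists q.
have [|q1 /andP[q1l q1r]] := rin y (y + e / 3); first lra.
have [|q2 /andP[q2l q2r]] := rin (y + e / 3) (y + 2 * e / 3); first lra.
have [|q3 /andP[q3l q3r]] := rin (y + 2 * e / 3) (y + e); first lra.
have [||z1 [l1 e1]] := val q1; [lra|lra|].
have [||z2 [l2 e2]] := val q2; [lra|lra|].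
have [||z3 [l3 e3]] := val q3; [lra|lra|].
apply: nprop.
apply: (three_rational_points _ _ _ _ _ _ _ _ _ _ _ hdet _ _ _ l1 l2 l3 e1 e2 e3).
- by apply/eqP => z12; move: e1; rewrite z12 e2 => E; lra.
- by apply/eqP => z13; move: e1; rewrite z13 e3 => E; lra.
- by apply/eqP => z23; move: e2; rewrite z23 e3 => E; lra.
Unshelve. all: by end_near. Qed.

(** Near [x0] the denominator stays between half and twice its value there, so the difference
    formula [mobiusB] makes M bi-Lipschitz. *)
Lemma mobius_window (R : realType) (a b c d x0 : R) (I : set R) :
  a * d - b * c != 0 -> open I -> I `<=` mobius_dom c d -> I x0 ->
  exists al be B mu lo hi : R,
  [/\ al < be, al <= x0 <= be, 1 <= B, 0 < lo & 0 <= hi] /\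
  [/\ forall x, al <= x <= be -> I x,
    forall x, al <= x <= be -> [/\ c * x + d != 0, `|c * x + d| <= mu,
     `|x| <= B & `|mobius a b c d x| <= B] &
    forall x y, al <= x <= be -> al <= y <= be ->
      lo * `|x - y| <= `|mobius a b c d x - mobius a b c d y| <= hi * `|x - y|].
Proof.
move=> hdet oI Idom Ix0; have l0 : c * x0 + d != 0 by exact: Idom.
set l := c * x0 + d in l0 *; have nl : 0 < `|l| by rewrite normr_gt0.
have /nbhs_ballP[r /= r0 Hr] : nbhs x0 I by apply: open_nbhs_nbhs.
have c1 : 0 < `|c| + 1 by rewrite ltr_wpDl.
(* The first bound keeps the window in [I], the second keeps the denominator from varying by more
   than half; the added 1 covers c = 0. *)
pose rho := Num.min (r / 2) (`|l| / (2 * (`|c| + 1))).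
have rho0 : 0 < rho by rewrite lt_min !divr_gt0 ?mulr_gt0.
have rhor : rho <= r / 2 by rewrite ge_min lexx.
have rhol : `|c| * rho <= `|l| / 2.
  apply: (@le_trans _ _ ((`|c| + 1) * rho)); first by rewrite ler_pM2r // lerDl.
  have : rho <= `|l| / (2 * (`|c| + 1)) by rewrite ge_min lexx orbT.
  by rewrite ler_pdivlMr ?mulr_gt0 // => ?; lra.
have inr x : x0 - rho <= x <= x0 + rho -> `|x - x0| <= rho.
  by rewrite ler_distl.
have lb x : x0 - rho <= x <= x0 + rho -> `|l| / 2 <= `|c * x + d| <= 2 * `|l|.
  move=> /inr xr; have -> : c * x + d = l - c * (x0 - x) by rewrite /l; ring.
  have h : `|c * (x0 - x)| <= `|l| / 2.
    by rewrite normrM distrC; apply: le_trans rhol; rewrite ler_wpM2l.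
  have h1 := lerB_dist l (c * (x0 - x)); have h2 := ler_normB l (c * (x0 - x)).
  by apply/andP; split; lra.
have Idisk x : x0 - rho <= x <= x0 + rho -> I x.
  by move=> /inr xr; apply: Hr; rewrite /ball /= distrC; lra.
have ln0 x : x0 - rho <= x <= x0 + rho -> c * x + d != 0.
  by move=> /Idisk /Idom.
set D := `|a * d - b * c|; have D0 : 0 < D by rewrite normr_gt0.
pose hi := D / (`|l| / 2 * (`|l| / 2)); pose lo := D / (2 * `|l| * (2 * `|l|)).
have hi0 : 0 < hi by rewrite /hi !(divr_gt0, mulr_gt0).
have lo0 : 0 < lo by rewrite /lo !(divr_gt0, mulr_gt0).
have lip x y : x0 - rho <= x <= x0 + rho -> x0 - rho <= y <= x0 + rho ->
    lo * `|x - y| <= `|mobius a b c d x - mobius a b c d y| <= hi * `|x - y|.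
  move=> xr yr; rewrite mobiusB ?ln0 // normrM normfV !normrM -/D.
  have /andP[x1 x2] := lb x xr; have /andP[y1 y2] := lb y yr.
  have hl : 0 < `|l| / 2 by rewrite divr_gt0.
  have px := lt_le_trans hl x1; have py := lt_le_trans hl y1.
  have lxy : 0 < `|c * x + d| * `|c * y + d| by rewrite mulr_gt0.
  have m1 : `|c * x + d| * `|c * y + d| <= 2 * `|l| * (2 * `|l|).
    by rewrite ler_pM.
  have m2 : `|l| / 2 * (`|l| / 2) <= `|c * x + d| * `|c * y + d|.
    by rewrite ler_pM // ltW.
  rewrite [D * `|x - y| / _]mulrAC /lo /hi; apply/andP; split.
    by rewrite ler_wpM2r // ler_pM2l // lef_pV2 ?posrE // mulr_gt0 // mulr_gt0.
  by rewrite ler_wpM2r // ler_pM2l // lef_pV2 ?posrE // mulr_gt0.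
have x0in : x0 - rho <= x0 <= x0 + rho by apply/andP; split; lra.
exists (x0 - rho), (x0 + rho).
exists (1 + `|x0| + rho + `|mobius a b c d x0| + hi * rho), (2 * `|l|), lo, hi.
have hr0 : 0 < hi * rho by rewrite mulr_gt0.
have nx0 := normr_ge0 x0; have ny0 := normr_ge0 (mobius a b c d x0).
split; first by split=> //; rewrite ?(ltW hi0) //; lra.
split=> // x xr; split; first exact: ln0.
- by have /andP[] := lb x xr.
- have := ler_normD x0 (x - x0); rewrite subrKC; have := inr x xr; lra.
have /andP[_ h] := lip x x0 xr x0in.
have h2 : hi * `|x - x0| <= hi * rho by rewrite ler_pM2l // inr.
have := ler_normD (mobius a b c d x0) (mobius a b c d x - mobius a b c d x0).
by rewrite subrKC; lra.
Qed.

(** A fraction p / q different from r0 / s0 is at least 1 / (s0 q) away, and s0 is at most a fixed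
    power of q. *)
Lemma not_liouville_fraction (R : realType) (r0 : int) (s0 : nat) :
  (0 < s0)%N -> ~ liouville (r0%:~R / s0%:R : R).
Proof.
move=> s0_gt0 /liouvilleP yL; have [h Hh] := exists_expn_ge R s0%:R.
have [p [q [q2 /andP[pq0 pqN]]]] := yL h.+1.
have q2R : 2 <= q%:R :> R by rewrite ler_nat.
have q0 : 0 < q%:R :> R by lra.
have s0R : 0 < s0%:R :> R by rewrite ltr0n.
have E : r0%:~R / s0%:R - p%:~R / q%:R =
    (r0 * q%:Z - p * s0%:Z)%:~R / (s0%:R * q%:R) :> R.
  by rewrite rmorphB !rmorphM /=; field; rewrite !gt_eqF.
have n0 : r0 * q%:Z - p * s0%:Z != 0.
  by apply: contraTneq pq0; rewrite E => ->; rewrite mul0r normr0 ltxx.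
move: pqN; apply/negP; rewrite -leNgt E normrM normfV.
have sq0 : 0 < s0%:R * q%:R :> R by rewrite mulr_gt0.
rewrite (gtr0_norm sq0); apply: (@le_trans _ _ (s0%:R * q%:R)^-1); last first.
  by rewrite ler_peMl ?invr_ge0 ?(ltW sq0) // intr_ge1.
have qh : 0 < q%:R ^+ h.+1 :> R by rewrite exprn_gt0.
rewrite lef_pV2 ?posrE // exprSr ler_pM2r //; apply: (le_trans Hh).
by rewrite lerXn2r ?nnegrE.
Qed.

(** * Assembly of the construction and the equivalence *)

Lemma exists_liouville_non_liouville_image (R : realType) (a b c d : R)
    (I : set R) :
  a * d - b * c != 0 -> ~ int_proportional R a b c d ->
  open I -> I !=set0 -> I `<=` mobius_dom c d ->
  exists xi : R, [/\ I xi, liouville xi & ~ liouville (mobius a b c d xi)].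
Proof.
move=> hdet nprop oI I0 Idom.
have [x0 [y0 [Ix0 My0 irr]]] :=
  exists_irrational_with_rational_image R a b c d I hdet nprop oI I0 Idom.
have den0 : (0 < `|denq y0|)%N by rewrite absz_gt0 denq_neq0.
have My : mobius a b c d x0 = (numq y0)%:~R / `|denq y0|%N%:R.
  by rewrite My0 /ratr natr_absz ger0_norm ?denq_ge0.
have [x0L|x0L] := pselect (liouville x0).
  by exists x0; split=> //; rewrite My; apply: not_liouville_fraction.
(* Irrationality of [x0] excludes zero distances, so failing to be Liouville yields a uniform lower
   bound. *)
have [N HN] : exists N : nat, forall (p : int) (q : nat), (2 <= q)%N ->
    q%:R ^- N <= `|x0 - p%:~R / q%:R|.
  apply: contrapT => nN; apply: x0L; apply/liouvilleP => N.
  apply: contrapT => nL; apply: nN; exists N => p q q2; rewrite leNgt.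
  apply/negP => pqN; apply: nL; exists p, q; split=> //; rewrite pqN andbT.
  rewrite normr_gt0 subr_eq0; apply/eqP => x0E; apply: (irr (p%:~R / q%:R)).
  by rewrite x0E fmorph_div rmorph_int rmorph_nat.
have [al [be [B [mu [lo [hi [[albe x0in B1 lo0 hi0] [inI bounds lip]]]]]]]] :=
  mobius_window R a b c d x0 I hdet oI Idom Ix0.
(* This choice makes both [kap] and [hi * kap] at most 1/2. *)
pose kap := (2 * (hi + 1))^-1; pose m := (8 * N + 8)%N.
have h1 : 0 < 2 * (hi + 1) by lra.
have kap0 : 0 < kap by rewrite invr_gt0.
have hik : hi * kap <= 2^-1.
  by rewrite /kap ler_pdivrMr //; lra.
have kap1 : kap <= 2^-1 by rewrite /kap lef_pV2 ?posrE //; lra.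
have m2 : (2 <= m)%N by rewrite /m; clear; lia.
have [xi [xiin xiL MxiL]] : exists xi : R,
    [/\ al <= xi <= be, liouville xi & ~ liouville (mobius a b c d xi)].
  apply: (@exists_liouville_nested R (mobius a b c d) al be kap m) => //.
  apply: (@nested_window_step R (mobius a b c d) al be hi kap m) => //.
  - by move=> x y xin yin; have /andP[] := lip x y xin yin.
  - exact: (exists_badly_approximable_image R a b c d al be B mu x0 (numq y0)
      `|denq y0|%N N hdet B1 bounds x0in den0 My HN).
  - exact: (window_avoiding_fractions R (mobius a b c d) al be lo hi kap m
      lo0 kap0 hik lip).
by exists xi; split=> //; apply: inI.
Qed.

Theorem theorem1p4 (R : realType) (a b c d : R) (hdet : a * d - b * c != 0) :
  (maillet (mobius_dom c d) (mobius a b c d)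
     <-> rational_coefs (mobius_frac a b c d))
  /\ (~ rational_coefs (mobius_frac a b c d) ->
      forall I : set R, open I -> is_interval I -> I !=set0 ->
        I `<=` mobius_dom c d ->
        exists xi : R, [/\ I xi, liouville xi & ~ liouville (mobius a b c d xi)]).
Proof.
have ratP := rational_coefsP R a b c d hdet.
split; last first.
  move=> nrat I oI _ I0 Idom.
  by apply: exists_liouville_non_liouville_image => // /ratP.
split=> [mai|/ratP]; last exact: int_proportional_maillet.
apply: contrapT => nrat.
(* The whole domain is open and nonempty, so the construction applied to it refutes Maillet's
   property. *)
have oD : open (mobius_dom c d).
  have -> : mobius_dom c d = (fun x : R => c * x + d) @^-1` [set r | r != 0] by [].
  apply: open_comp; last exact: open_neq.
  by move=> x _; exact: affine_continuous.
have D0 : mobius_dom c d !=set0.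
  have [n] := exists_nat_nonroot R _ (mobius_den_neq0 R a b c d hdet).
  by rewrite /root !hornerE => nn; exists n%:R.
have [xi [xiD xiL]] := exists_liouville_non_liouville_image R a b c d _ hdet
  (fun h => nrat (ratP.2 h)) oD D0 (@subset_refl _ _).
by apply; apply: mai.
Qed.
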